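(* Let $(X,d)$ be a countably generated Lorentzian metric space, and let $\{Y_i\}_{i\in\mathbb{N}}$ be a family of compact subsets of $X$ such that $Y_i\subset Y_j$ for every $i\le j$, and $\bigcup_{i\in\mathbb{N}}Y_i=X$. Then there is a family of time functions $\tau_i: BY_i\to[-1,1]$, $i\in\mathbb{N}$, such that the function $\tau:X\to[-1,1]$, $$\tau(x):=\lim_{i\to\infty}\tau_i([x]_{Y_i}),\qquad x\in X,$$ is well defined and is a time function on $X$. (For given $x$ the expression under the limit needs to make sense only for all sufficiently large $i$.)
   Context: Let $X$ be a set and $d:X\times X\to[0,+\infty)$ a function. Notation: $x\ll y$ iff $d(x,y)>0$; $I^+(x)=\{y: x\ll y\}$, $I^-(x)=\{y: y\ll x\}$; for $A\subset X$, $I^\pm(A)=\bigcup_{p\in A}I^\pm(p)$ and $I(A)=I^+(A)\cap I^-(A)$; $I(p,q):=I(\{p,q\})$. For $\epsilon>0$, $I_\epsilon=\{(x,y): d(x,y)\ge\epsilon\}$. $(X,d)$ is a Lorentzian metric space if: (i) $d(x,z)\ge d(x,y)+d(y,z)$ whenever $d(x,y)>0$ and $d(y,z)>0$; (ii) there is a topology $T$ on $X$ such that $d$ is continuous in the product topology and, for every $x,y\in X$ and $\epsilon>0$, the set $I_\epsilon\cap(\overline{I(x,y)}\times\overline{I(x,y)})$ is compact; (iii) for all $x\ne y$ there is $z\in X$ with $d(x,z)\ne d(y,z)$ or $d(z,x)\ne d(z,y)$. It is countably generated if there is a countable $\mathscr{G}\subset X$ with $X=I(\mathscr{G})$; then the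 topology in (ii) is unique and $X$ is endowed with it. Causal relation: for a set $Z$ with function $d:Z\times Z\to[0,\infty)$, $x\le y$ means $d(p,y)\ge d(p,x)$ and $d(x,p)\ge d(y,p)$ for all $p\in Z$; $x<y$ means $x\le y$ and $x\ne y$. A time function on $Z$ (with a topology) is a continuous function $\tau:Z\to\mathbb{R}$ with $\tau(x)<\tau(y)$ whenever $x<y$. For compact $Y\subset X$: $I^0(Y)=\{y\in Y: d(x,y)=d(y,x)=0\ \forall x\in Y\}$, $\mathring{Y}=Y\setminus I^0(Y)$. On $\mathring{Y}$ let $x\sim y$ iff $d(x,z)=d(y,z)$ and $d(z,x)=d(z,y)$ for all $z\in\mathring{Y}$. Then $BY:=\mathring{Y}/\!\sim$ with the induced function $d_{BY}([x],[y])=d(x,y)$ and the quotient of the topology induced from $X$ on $\mathring Y$; $[x]_Y\in BY$ denotes the class of $x\in\mathring{Y}$. Time functions on $BY$ refer to $d_{BY}$ and this topology. *)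

(* Defs.v *)
From HB Require Import structures.
From mathcomp Require Import all_boot all_order all_algebra.
From mathcomp Require Import generic_quotient.
From mathcomp Require Import all_classical all_reals all_analysis.

Set Implicit Arguments.
Unset Strict Implicit.
Unset Printing Implicit Defensive.

Import Order.TTheory GRing.Theory Num.Theory.
Import numFieldNormedType.Exports.

Local Open Scope classical_set_scope.
Local Open Scope ring_scope.
Local Open Scope quotient_scope.

Section Chronology.
Context {R : realType} {T : Type} (d : T -> T -> R).

Definition chron_future (x : T) : set T := [set y | 0 < d x y].
Definition chron_past (x : T) : set T := [set y | 0 < d y x].

Definition chron_hull (A : set T) : set T :=
  (\bigcup_(p in A) chron_future p) `&` (\bigcup_(p in A) chron_past p).

Definition causal_le (x y : T) : Prop :=
  forall p, d p x <= d p y /\ d y p <= d x p.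

Definition causal_lt (x y : T) : Prop := causal_le x y /\ x <> y.

End Chronology.

(* The usual definition asks that some topology on T satisfies lms_continuous
   and lms_compact. Here that topology is the one T carries: when T is countably
   generated there is only one, and T is endowed with it. *)
Record lorentzian_metric_space {R : realType} {T : topologicalType}
    (d : T -> T -> R) : Prop := {
  lms_ge0 : forall x y, 0 <= d x y ;
  lms_reverse_triangle : forall x y z,
    0 < d x y -> 0 < d y z -> d x y + d y z <= d x z ;
  lms_continuous : continuous (fun xy : T * T => d xy.1 xy.2) ;
  lms_compact : forall (x y : T) (e : R), 0 < e ->
    compact ([set uv : T * T | e <= d uv.1 uv.2] `&`
      (closure (chron_hull d [set x; y]) `*`
       closure (chron_hull d [set x; y]))) ;
  lms_distinguishing : forall x y, x <> y ->
    exists z, d x z <> d y z \/ d z x <> d z y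
}.

Definition countably_generated {R : realType} {T : Type} (d : T -> T -> R) :
    Prop :=
  exists G : set T, countable G /\ chron_hull d G = [set: T].

Definition time_function {R : realType} {T : topologicalType}
    (d : T -> T -> R) (tau : T -> R) : Prop :=
  continuous tau /\ forall x y, causal_lt d x y -> tau x < tau y.

Section BoundingQuotient.
Context {R : realType} {X : topologicalType} (d : X -> X -> R) (Y : set X).

Definition I0 : set X :=
  [set y | Y y /\ forall x, Y x -> d x y = 0 /\ d y x = 0].

Definition mathring : set X := Y `\` I0.

Definition indist : rel mathring := fun x y =>
  `[< forall z : mathring, d (val x) (val z) = d (val y) (val z) /\
                       d (val z) (val x) = d (val z) (val y) >].

Lemma indist_refl : reflexive indist.
Proof. by move=> x; apply/asboolP. Qed.

Lemma indist_sym : symmetric indist.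
Proof.
by move=> x y; apply/asboolP/asboolP => h z; have [-> ->] := h z.
Qed.

Lemma indist_trans : transitive indist.
Proof.
move=> y x z /asboolP hxy /asboolP hyz; apply/asboolP => w.
by have [-> ->] := hxy w; exact: hyz.
Qed.

Definition indist_equiv : equiv_rel mathring :=
  EquivRel indist indist_refl indist_sym indist_trans.

(* mathring, read as a type, carries the subspace topology inherited from X. *)
Definition BY : topologicalType :=
  quotient_topology {eq_quot indist_equiv}.

Definition BYclass (x : mathring) : BY :=
  \pi_(quotient_topology {eq_quot indist_equiv}) x.

Definition BYrepr (a : BY) : mathring :=
  repr (a : quotient_topology {eq_quot indist_equiv}).

Definition dBY (a b : BY) : R := d (val (BYrepr a)) (val (BYrepr b)).

Lemma BYreprP (x : mathring) : indist (BYrepr (BYclass x)) x.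
Proof.
have /eqquotP := reprK (BYclass x : {eq_quot indist_equiv}).
by [].
Qed.

Lemma dBYE (x y : mathring) : dBY (BYclass x) (BYclass y) = d (val x) (val y).
Proof.
have /asboolP hx := BYreprP x; have /asboolP hy := BYreprP y.
by rewrite /dBY (hx _).1 (hy _).2.
Qed.

(* x |-> f [x]_Y, with value 0 at the points having no class in BY. *)
Definition at_class (f : BY -> R) (x : X) : R :=
  if insub x is Some u then f (BYclass u) else 0.

Lemma at_classE (f : BY -> R) (x : mathring) : at_class f (val x) = f (BYclass x).
Proof. by rewrite /at_class valK. Qed.

End BoundingQuotient.

Arguments dBY {R X} d Y.

(* Main.v *)
(* On a compact set Y the distances to and from a point of Y form a compact, hence
   separable, family of continuous functions, so a countable subset of Y already
   separates any two points which Y separates. Enumerate the union of these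
   subsets for all Y_i as p_0, p_1, ..., put f t = t / (1 + t), and let tau_i be
   the sum of 2^-(n+1) (f (d p_n x) - f (d x p_n)) over those n with p_n in Y_i.
   Restricting to p_n in Y_i makes tau_i depend on the class of x only, and
   monotone for the causal relation of BY_i. By dominated convergence tau_i tends
   to the sum over all n, which is a time function on X. *)
Require Import Defs.
From HB Require Import structures.
From mathcomp Require Import all_boot all_order all_algebra.
From mathcomp Require Import all_classical all_reals all_analysis.
From mathcomp Require Import generic_quotient.
From mathcomp Require Import lra.

Import Order.TTheory GRing.Theory Num.Theory.
Import numFieldNormedType.Exports.

Local Open Scope classical_set_scope.
Local Open Scope ring_scope.

(** * Compactness and countable separating families *)

(* [compact_cover] of the library is only available for pointed spaces; here the
   finite subsets, ordered by inclusion, serve as the filter of a near-covering. *)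
Lemma compact_finite_subcover (T : topologicalType) (K : set T)
    (V : T -> set T) : compact K -> (forall z, K z -> nbhs z (V z)) ->
  exists S, [/\ finite_set S, S `<=` K & K `<=` \bigcup_(z in S) V z].
Proof.
move=> /compact_near_coveringP Kc nV.
pose F : set_system (set T) :=
  [set P | exists2 S, finite_set S & forall S', S `<=` S' -> P S'].
have FF : Filter F.
  split; first by exists set0.
  - move=> P Q [S fS SP] [S' fS' SQ]; exists (S `|` S').
      by rewrite finite_setU.
    by move=> S''; rewrite subUset => -[SS SS']; split; [exact: SP|exact: SQ].
  - by move=> P Q PQ [S fS SP]; exists S => // S' /SP; exact: PQ.
have [|S fS SP] := Kc _ F (fun S x => exists2 z, (S `&` K) z & V z x) FF.
  move=> x Kx; exists (V x, [set S | S x]) => /=.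
    split; first exact: nV.
    by exists [set x] => // S'; apply.
  by move=> [w S] [/= Vw Sx]; exists x.
exists (S `&` K); split; [exact: finite_setIl|by move=> ? []|].
by move=> x /(SP S (@subset_refl _ S)) [z Sz Vz]; exists z.
Qed.

(** Each [(z, x)] has a product neighbourhood on which [F] stays within [e / 2] of [F z x], so
    [(z, y)] and [(w, y)] in it have [e]-close values; near-covering compactness of [L] makes this
    uniform. *)
Lemma compact_tube (R : realType) (T U : topologicalType) (F : T -> U -> R)
    (L : set U) (z : T) (e : R) :
  continuous (fun zx : T * U => F zx.1 zx.2) -> compact L -> 0 < e ->
  \forall w \near z, forall x, L x -> `|F z x - F w x| < e.
Proof.
move=> cF /compact_near_coveringP Lc e0.
apply: (Lc T (nbhs z) (fun w x => `|F z x - F w x| < e)) => x _.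
have e20 : 0 < e / 2 by rewrite divr_gt0.
have [[A B] /= [zA xB] AB] := cvgr_dist_lt _ _ (cF (z, x)) _ e20.
exists (B, A) => // -[y w] [/= By Aw].
have /= h1 := AB (z, y) (conj (nbhs_singleton zA) By).
have /= h2 := AB (w, y) (conj Aw By).
rewrite (splitr e) (le_lt_trans (ler_distD (F z x) _ _)) // ltrD //.
by rewrite distrC.
Qed.

(* The maps [F z], [z] in [K], form a compact subset of the separable metric
   space of continuous functions on [L]. *)
Lemma countable_separating (R : realType) (T U : topologicalType)
    (F : T -> U -> R) (K : set T) (L : set U) :
  continuous (fun zx : T * U => F zx.1 zx.2) -> compact K -> compact L ->
  exists S, [/\ countable S, S `<=` K & forall x y z, L x -> L y -> K z ->
    F z x <> F z y -> exists2 s, S s & F s x <> F s y].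
Proof.
move=> cF Kc Lc.
have /choice[S SP] : forall k : nat, exists S, [/\ finite_set S, S `<=` K &
    K `<=` \bigcup_(z in S) [set w | forall x, L x -> `|F z x - F w x| < k.+1%:R^-1]].
  by move=> k; apply: compact_finite_subcover => // z _; exact: compact_tube.
exists (\bigcup_k S k); split.
- by apply: bigcup_countable => // k _; apply: finite_set_countable; case: (SP k).
- by move=> x [k _]; case: (SP k) => _ + _ => /[apply].
move=> x y z Lx Ly Kz /eqP neq.
(* Half the gap: if [s] took equal values at [x] and [y], two errors below this could not bridge the
   gap. *)
have e0 : 0 < `|F z x - F z y| / 2 by rewrite divr_gt0// normr_gt0 subr_eq0.
have [k _ /(_ k (leqnn k)) /= ke] : \forall k \near \oo,
    k.+1%:R^-1 < `|F z x - F z y| / 2 by exact: near_infty_natSinv_lt (PosNum e0).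
have [_ _ /(_ z Kz) [s Ss hs]] := SP k.
exists s; first by exists k.
move=> eqs; have /= hx := hs x Lx; have /= hy := hs y Ly.
rewrite eqs distrC in hx.
have := ler_distD (F s y) (F z x) (F z y).
rewrite leNgt => /negP; apply; rewrite [ltRHS]splitr ltrD//.
  exact: lt_trans hx ke.
exact: lt_trans hy ke.
Qed.

(** [None] fills the indices without a preimage, so [D] and even [T] may be empty. *)
Lemma countable_enum (T : Type) (D : set T) : countable D ->
  exists p : nat -> option T, forall s, D s -> exists n, p n = Some s.
Proof.
move=> /countable_injP[f finj].
exists (fun n => if pselect (exists2 s, D s & f s = n) is left h
  then Some (s2val (cid2 h)) else None) => s Ds; exists (f s).
case: pselect => [h|[]]; last by exists s.
by case: cid2 => /= t Dt /finj ->//; rewrite inE.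
Qed.

(** * Series with dyadic weights *)

Section DyadicSum.
Context {R : realType}.
Implicit Types (u v : nat -> R).

Definition dyadic_sum u : R := limn (series (fun n => 2^-1 ^+ n.+1 * u n)).

(** The weights of the terms [N] to [n - 1] add up to the right-hand side. *)
Lemma dyadic_partial_tail u N n : (forall k, `|u k| <= 1) -> (N <= n)%N ->
  `|series (fun n => 2^-1 ^+ n.+1 * u n) n -
    series (fun n => 2^-1 ^+ n.+1 * u n) N| <= 2^-1 ^+ N - 2^-1 ^+ n.
Proof.
move=> u1 /subnK <-; elim: (n - N)%N => [|m IH].
  by rewrite add0n !subrr normr0.
rewrite addSn seriesSr addrAC (le_trans (ler_normD _ _))//.
have um : `|2^-1 ^+ (m + N).+1 * u (m + N)%N| <= 2^-1 ^+ (m + N).+1.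
  by rewrite normrM ger0_norm ?exprn_ge0// ler_piMr ?exprn_ge0.
by apply: le_trans (lerD IH um) _; rewrite exprS; lra.
Qed.

Lemma cvg_dyadic u : (forall k, `|u k| <= 1) ->
  cvgn (series (fun n => 2^-1 ^+ n.+1 * u n)).
Proof.
move=> u1; apply: normed_cvg.
apply: (@series_le_cvg _ _ (geometric 2^-1 2^-1)) => [n|n|n|].
- exact: normr_ge0.
- by rewrite /geometric /= mulr_ge0// exprn_ge0.
- by rewrite /geometric /= normrM ger0_norm ?exprn_ge0// -exprS ler_piMr ?exprn_ge0.
- by apply: is_cvg_geometric_series; rewrite ger0_norm; lra.
Qed.

(** The bound is independent of [u], which is what permits limits term by term. *)
Lemma dyadic_sum_tail u N : (forall k, `|u k| <= 1) ->
  `|dyadic_sum u - series (fun n => 2^-1 ^+ n.+1 * u n) N| <= 2^-1 ^+ N.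
Proof.
move=> u1; have cu := cvg_dyadic _ u1; set s := series _ in cu *.
have cs : `|s n - s N| @[n --> \oo] --> `|dyadic_sum u - s N|.
  by apply: cvg_norm; apply: cvgB; [exact: cu|exact: cvg_cst].
rewrite -(cvg_lim _ cs)//; apply: limr_le; first by apply/cvg_ex; eexists; exact: cs.
exists N => // n /= Nn; apply: le_trans (dyadic_partial_tail _ _ _ u1 Nn) _.
by rewrite gerBl exprn_ge0.
Qed.

Lemma dyadic_sum_bound u : (forall k, `|u k| <= 1) -> -1 <= dyadic_sum u <= 1.
Proof.
move=> u1; have := dyadic_sum_tail _ 0 u1.
by rewrite seriesEnat /= big_geq// subr0 expr0 ler_norml.
Qed.

(** Dominated convergence: for a suitable [N] both tails are below [e / 3], uniformly in [t], and a
    finite sum remains. The general filter serves both for continuity at a point and for the limit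
    over [i]. *)
Lemma cvg_dyadic_sum (T : Type) (F : set_system T) (FF : Filter F)
    (u : T -> nat -> R) v :
  (forall t k, `|u t k| <= 1) -> (forall k, `|v k| <= 1) ->
  (forall k, u t k @[t --> F] --> v k) ->
  dyadic_sum (u t) @[t --> F] --> dyadic_sum v.
Proof.
move=> u1 v1 uv; apply/cvgrPdist_lt => e e0.
have e3 : 0 < e / 3 by rewrite divr_gt0.
have [N _ /(_ N (leqnn N)) /= Ne] := near_infty_natSinv_expn_lt (PosNum e3).
have {}Ne : 2^-1 ^+ N < e / 3 by rewrite exprVn -div1r.
have : series (fun n => 2^-1 ^+ n.+1 * u t n) N @[t --> F] -->
    series (fun n => 2^-1 ^+ n.+1 * v n) N.
  elim: N {Ne} => [|N IH].
    under eq_cvg do rewrite seriesEnat /= big_geq//.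
    rewrite seriesEnat /= big_geq//.
    exact: cvg_cst.
  rewrite seriesSr; under eq_cvg do rewrite seriesSr.
  by apply: cvgD => //; apply: cvgM; [exact: cvg_cst|exact: uv].
move=> /(cvgr_dist_lt _ _) /(_ _ e3); apply: filterS => t.
have := dyadic_sum_tail _ N v1; have := dyadic_sum_tail _ N (u1 t).
set a := series _ _; set b := series _ _.
move=> /le_lt_trans/(_ Ne) h1 /le_lt_trans/(_ Ne) h2 h3.
rewrite !ltr_norml in h1 h2 h3 *; lra.
Qed.

(** The difference series has nonnegative terms, so its sum is at least the partial sum ending with
    the positive term [m]. *)
Lemma ltr_dyadic_sum u v m : (forall k, `|u k| <= 1) -> (forall k, `|v k| <= 1) ->
  (forall k, u k <= v k) -> u m < v m -> dyadic_sum u < dyadic_sum v.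
Proof.
move=> u1 v1 uv uvm; rewrite -subr_gt0.
have cu := cvg_dyadic _ u1; have cv := cvg_dyadic _ v1.
rewrite /dyadic_sum -lim_seriesB//.
have term_ge0 k : 0 <= 2^-1 ^+ k.+1 * v k - 2^-1 ^+ k.+1 * u k.
  by rewrite -mulrBr mulr_ge0 ?exprn_ge0// subr_ge0.
have nd := nondecreasing_series (fun n _ (_ : xpredT n) => term_ge0 n) (m := 0).
have := nondecreasing_cvgn_le nd (is_cvg_seriesB cv cu) m.+1.
apply: lt_le_trans; rewrite big_nat_recr//= ltr_wpDl//.
  by apply: sumr_ge0 => i _; exact: term_ge0.
by rewrite -mulrBr mulr_gt0 ?exprn_gt0 ?subr_gt0.
Qed.

End DyadicSum.

(** * Bounded rescaling of nonnegative distances *)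

Section Squash.
Context {R : realType}.
Implicit Types a b : R.

Definition squash a := a / (1 + a).

Lemma squash_ge0 a : 0 <= a -> 0 <= squash a.
Proof. by move=> a0; rewrite divr_ge0// addr_ge0. Qed.

Lemma squash_le1 a : 0 <= a -> squash a <= 1.
Proof. by move=> a0; rewrite ler_pdivrMr; lra. Qed.

Lemma ltr_squash a b : 0 <= a -> a < b -> squash a < squash b.
Proof.
move=> a0 ab; rewrite /squash ltr_pdivrMr; last lra.
by rewrite mulrAC ltr_pdivlMr; nra.
Qed.

Lemma ler_squash a b : 0 <= a -> a <= b -> squash a <= squash b.
Proof.
by move=> a0; rewrite le_eqVlt => /predU1P[->//|/(ltr_squash _ _ a0)/ltW].
Qed.

Lemma continuous_squash a : 0 <= a -> {for a, continuous squash}.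
Proof.
move=> a0; apply: cvgM; first exact: cvg_id.
apply: cvgV; first by rewrite gt_eqF//; lra.
by apply: cvgD; [exact: cvg_cst|exact: cvg_id].
Qed.

End Squash.

(** * Weighted sums of rescaled distances on [X] *)

Section TimeFunction.
Context {R : realType} {X : topologicalType} (d : X -> X -> R).
Hypothesis d_ge0 : forall x y, 0 <= d x y.
Hypothesis d_cont : continuous (fun xy : X * X => d xy.1 xy.2).

(* The [None]s and the points outside [A] contribute nothing, so that enlarging
   [A] only switches on further terms of a fixed series. *)
Definition chron_term (A : set X) (o : option X) (x : X) : R :=
  if o is Some s then
    if s \in A then squash (d s x) - squash (d x s) else 0
  else 0.

Variable p : nat -> option X.

Definition chron_time (A : set X) (x : X) : R :=
  dyadic_sum (fun n => chron_term A (p n) x).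

Lemma chron_term_bound A o x : `|chron_term A o x| <= 1.
Proof.
rewrite /chron_term; case: o => [s|]; last by rewrite normr0.
case: ifP => _; last by rewrite normr0.
have := squash_ge0 _ (d_ge0 s x); have := squash_le1 _ (d_ge0 s x).
have := squash_ge0 _ (d_ge0 x s); have := squash_le1 _ (d_ge0 x s).
by rewrite ler_norml; lra.
Qed.

Lemma chron_time_bound A x : -1 <= chron_time A x <= 1.
Proof. by apply: dyadic_sum_bound => k; exact: chron_term_bound. Qed.

Lemma continuous_chron_time A : continuous (chron_time A).
Proof.
move=> x; apply: cvg_dyadic_sum => [y k|k|k]; try exact: chron_term_bound.
rewrite /chron_term; case: (p k) => [s|]; last exact: cvg_cst.
case: (s \in A); last exact: cvg_cst.
apply: cvgB.
- apply: (continuous_comp (f := d s)); last exact: continuous_squash.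
  apply: (continuous_comp (f := pair s) (g := fun xy : X * X => d xy.1 xy.2)).
    by apply: cvg_pair; [exact: cvg_cst|exact: cvg_id].
  exact: d_cont.
- apply: (continuous_comp (f := d ^~ s)); last exact: continuous_squash.
  apply: (continuous_comp (f := pair ^~ s) (g := fun xy : X * X => d xy.1 xy.2)).
    by apply: cvg_pair; [exact: cvg_id|exact: cvg_cst].
  exact: d_cont.
Qed.

Lemma chron_term_le A o x y :
  (forall s, A s -> d s x <= d s y /\ d y s <= d x s) ->
  chron_term A o x <= chron_term A o y.
Proof.
move=> le_xy; case: o => [s|] //=; case: ifPn => // /set_mem /le_xy[h1 h2].
by rewrite lerB// ler_squash.
Qed.

Lemma chron_time_eq A x y :
  (forall s, A s -> d s x = d s y /\ d y s = d x s) ->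
  chron_time A x = chron_time A y.
Proof.
move=> eq_xy; congr (dyadic_sum _); apply/funext => n.
by rewrite /chron_term; case: (p n) => // s; case: ifPn => // /set_mem /eq_xy[-> ->].
Qed.

(** All terms are monotone, and that of [s] is strictly so, whichever of its two distances
    differs. *)
Lemma chron_time_lt A n s x y :
  (forall s, A s -> d s x <= d s y /\ d y s <= d x s) ->
  p n = Some s -> A s -> d s x <> d s y \/ d x s <> d y s ->
  chron_time A x < chron_time A y.
Proof.
move=> le_xy pn As neq; apply: (ltr_dyadic_sum _ _ n) => [k|k|k|];
  [exact: chron_term_bound|exact: chron_term_bound|exact: chron_term_le|].
rewrite /chron_term pn mem_set//; have [h1 h2] := le_xy s As.
case: neq => /eqP neq.
- by rewrite ltr_leB ?ler_squash ?ltr_squash// lt_neqAle neq.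
- by rewrite ler_ltB ?ler_squash ?ltr_squash// lt_neqAle eq_sym neq.
Qed.

(** Each term is eventually constant in [i]: its point, if any, lies in [Y i] from some index on. *)
Lemma chron_time_cvg (Y : nat -> set X) (x : X) :
  (forall i j, (i <= j)%N -> Y i `<=` Y j) -> \bigcup_i Y i = [set: X] ->
  chron_time (Y i) x @[i --> \oo] --> chron_time setT x.
Proof.
move=> Ymono Ycover; apply: cvg_dyadic_sum => [i k|k|k]; try exact: chron_term_bound.
case: (p k) => [s|] /=; last exact: cvg_cst.
have [i _ Yis] : (\bigcup_i Y i) s by rewrite Ycover.
rewrite mem_set//; apply: cvg_near_cst; exists i => // j /= ij.
by rewrite mem_set//; exact: Ymono Yis.
Qed.

End TimeFunction.

(** * Descent to [BY] *)

Section BoundingQuotientFacts.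
Context {R : realType} {X : topologicalType} (d : X -> X -> R) (Y : set X).
Implicit Types (a b : BY d Y) (u : mathring d Y).

Lemma mem_mathring u : Y (val u).
Proof. by have /set_mem[] := valP u. Qed.

(* A point of [Y] without a class in [BY] is at distance zero from all of [Y],
   so it imposes no condition on other points of [Y]. *)
Lemma dist_mathring (P : R -> R -> Prop) (x y s : X) :
  P 0 0 -> Y x -> Y y -> Y s ->
  (forall w : mathring d Y,
    P (d (val w) x) (d (val w) y) /\ P (d y (val w)) (d x (val w))) ->
  P (d s x) (d s y) /\ P (d y s) (d x s).
Proof.
move=> P0 Yx Yy Ys Pw; have [[_ sI0]|sI0] := pselect (I0 d Y s).
  by have [-> ->] := sI0 x Yx; have [-> ->] := sI0 y Yy.
have ms : s \in mathring d Y by rewrite inE.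
exact: (Pw (SigSub ms)).
Qed.

Lemma indist_repr_eq a b : indist (BYrepr a) (BYrepr b) -> a = b.
Proof.
move=> ab; rewrite -(reprK (a : {eq_quot indist_equiv d Y}%qT)).
rewrite -[RHS](reprK (b : {eq_quot indist_equiv d Y}%qT)).
exact/eqquotP.
Qed.

Lemma dBY_classl u a : dBY d Y (BYclass u) a = d (val u) (val (BYrepr a)).
Proof. by have /asboolP/(_ (BYrepr a))[+ _] := BYreprP u. Qed.

Lemma dBY_classr u a : dBY d Y a (BYclass u) = d (val (BYrepr a)) (val u).
Proof. by have /asboolP/(_ (BYrepr a))[_ +] := BYreprP u. Qed.

(** The relation on [BY] tests only points having a class; [dist_mathring] extends it to all of [Y],
    since enumerated points may lie in [I0 d Y]. *)
Lemma causal_le_BY a b (s : X) : causal_le (dBY d Y) a b -> Y s ->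
  d s (val (BYrepr a)) <= d s (val (BYrepr b)) /\
  d (val (BYrepr b)) s <= d (val (BYrepr a)) s.
Proof.
move=> ab Ys; apply: (dist_mathring (fun r t => r <= t)) => //;
  try exact: mem_mathring.
by move=> w; have := ab (BYclass w); rewrite !dBY_classl !dBY_classr.
Qed.

Lemma neq_BY a b : a <> b -> exists w : mathring d Y,
  d (val w) (val (BYrepr a)) <> d (val w) (val (BYrepr b)) \/
  d (val (BYrepr a)) (val w) <> d (val (BYrepr b)) (val w).
Proof.
move=> ab; apply: contrapT => /forallNP noW; apply/ab/indist_repr_eq/asboolP => w.
by have /not_orP[/contrapT ? /contrapT ?] := noW w.
Qed.

Hypothesis d_ge0 : forall x y, 0 <= d x y.
Hypothesis d_cont : continuous (fun xy : X * X => d xy.1 xy.2).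
Variable p : nat -> option X.

(** Points of one class have the same distances to and from all of [Y], so the choice of
    representative does not matter. *)
Lemma chron_time_BYclass u :
  chron_time d p Y (val (BYrepr (BYclass u))) = chron_time d p Y (val u).
Proof.
apply: chron_time_eq => s Ys.
apply: (dist_mathring (fun r t => r = t)) => //; try exact: mem_mathring.
by move=> w; have /asboolP/(_ w)[-> ->] := BYreprP u.
Qed.

Lemma continuous_chron_time_BY :
  continuous (fun a : BY d Y => chron_time d p Y (val (BYrepr a))).
Proof.
(* Continuity is checked after the projection, where the function is the restriction of a continuous
   one to a subspace. *)
apply/quotient_continuous.
rewrite [X in continuous X](_ : _ = chron_time d p Y \o val).
  move=> u; apply: continuous_comp; first exact: initial_continuous.
  exact: continuous_chron_time.
by apply/funext => u; exact: chron_time_BYclass.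
Qed.

End BoundingQuotientFacts.

Theorem lemma4p12 (R : realType) (X : topologicalType) (d : X -> X -> R)
    (hd : lorentzian_metric_space d) (hcg : countably_generated d)
    (Y : nat -> set X)
    (Ycompact : forall i, compact (Y i))
    (Ymono : forall i j, (i <= j)%N -> Y i `<=` Y j)
    (Ycover : \bigcup_i Y i = [set: X]) :
  exists tau_ : forall i, BY d (Y i) -> R,
    [/\ forall i, time_function (dBY d (Y i)) (tau_ i) /\
          (forall a, -1 <= tau_ i a <= 1),
        forall x : X, (\forall i \near \oo, mathring d (Y i) x) /\
          cvgn (fun i => at_class (tau_ i) x : R) &
        let tau := fun x : X => limn (fun i => at_class (tau_ i) x : R) in
        time_function d tau /\ (forall x, -1 <= tau x <= 1)].
Proof.
have d_ge0 := lms_ge0 hd; have d_cont := lms_continuous hd.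
have dT_cont : continuous (fun xy : X * X => d xy.2 xy.1).
  move=> xy.
  apply: (continuous_comp (f := fun xy : X * X => (xy.2, xy.1))
    (g := fun xy : X * X => d xy.1 xy.2)); last exact: d_cont.
  by apply: cvg_pair; [exact: cvg_snd|exact: cvg_fst].
have /choice[D DP] : forall i, exists S, [/\ countable S, S `<=` Y i &
    forall x y z, Y i x -> Y i y -> Y i z ->
      d z x <> d z y \/ d x z <> d y z ->
      exists2 s, S s & d s x <> d s y \/ d x s <> d y s].
  move=> i.
  have [S [cS SY sepS]] :=
    countable_separating _ _ _ _ _ _ d_cont (Ycompact i) (Ycompact i).
  (* The first family separates through [d z x], this one through [d x z]. *)
  have [S' [cS' S'Y sepS']] :=
    countable_separating _ _ _ (fun z x => d x z) _ _ dT_cont (Ycompact i) (Ycompact i).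
  exists (S `|` S'); split.
  - by rewrite -bigcup2E; apply: bigcup_countable => // -[|[|k]] _ //=.
  - by rewrite subUset.
  - by move=> x y z Yx Yy Yz [/(sepS _ _ _ Yx Yy Yz)|/(sepS' _ _ _ Yx Yy Yz)][s Ss neq];
      exists s; [left|left|right|right].
have cD : countable (\bigcup_i D i).
  by apply: bigcup_countable => // i _; case: (DP i).
have [p pP] := countable_enum _ _ cD.
have sep i x y z : Y i x -> Y i y -> Y i z ->
    d z x <> d z y \/ d x z <> d y z -> exists n s,
    [/\ p n = Some s, Y i s & d s x <> d s y \/ d x s <> d y s].
  have [_ DY Dsep] := DP i.
  move=> Yx Yy Yz /(Dsep _ _ _ Yx Yy Yz)[s Ds neq].
  have [n pn] := pP s (ex_intro2 _ _ i I Ds).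
  by exists n, s; split => //; exact: DY.
have eventually_mem x : \forall i \near \oo, Y i x.
  have [i _ Yix] : (\bigcup_i Y i) x by rewrite Ycover.
  by exists i => // j /= ij; exact: Ymono Yix.
have eventually_mathring x : \forall i \near \oo, mathring d (Y i) x.
  have [G [_ hullG]] := hcg.
  (* Some [q] has [0 < d q x]; once [Y i] contains [q] and [x], the point [x] is outside [I0] and
     has a class. *)
  have [[q _ qx] _] : chron_hull d G x by rewrite hullG.
  near=> i; split; first by near: i; exact: eventually_mem.
  move=> [_ /(_ q) []]; first by near: i; exact: eventually_mem.
  by move=> qx0 _; move: qx; rewrite /chron_future /= qx0 ltxx.
pose tau_ i (a : BY d (Y i)) := chron_time d p (Y i) (val (BYrepr a)).
have cvg_tau x : at_class (tau_ i) x @[i --> \oo] --> chron_time d p setT x.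
  (* The default [0] of [at_class] affects only finitely many [i], so the limit is unchanged. *)
  have := chron_time_cvg _ d_ge0 p _ x Ymono Ycover.
  apply: cvg_trans; apply: near_eq_cvg.
  apply: filterS (eventually_mathring x) => i mx.
  have mx' : x \in mathring d (Y i) by rewrite inE.
  rewrite -[x]/(val (SigSub mx' : mathring d (Y i))) at_classE.
  by rewrite /tau_ chron_time_BYclass.
exists tau_; split.
- move=> i; split; last by move=> a; exact: chron_time_bound.
  split; first exact: continuous_chron_time_BY.
  move=> a b [ab /neq_BY[w neq]].
  have [n [s [pn Ys neqs]]] :=
    sep i _ _ _ (mem_mathring _ _ _) (mem_mathring _ _ _) (mem_mathring _ _ w) neq.
  apply: (chron_time_lt _ d_ge0 _ _ _ _ _ _ _ pn Ys neqs) => t; exact: causal_le_BY.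
- move=> x; split; first exact: eventually_mathring.
  by apply/cvg_ex; eexists; exact: cvg_tau.
- move=> tau; have -> : tau = chron_time d p setT.
    by apply/funext => x; apply: cvg_lim => //; exact: cvg_tau.
  split; last by move=> x; exact: chron_time_bound.
  split; first exact: continuous_chron_time.
  move=> x y [xy /(lms_distinguishing hd)[z neq]].
  (* Separation is available inside a single [Y i], so [x], [y] and [z] are put in a common one; the
     separating [s] then counts in the full sum. *)
  have [i [Yx Yy Yz]] : exists i, [/\ Y i x, Y i y & Y i z].
    apply: (@filter_ex _ \oo); near=> i.
    by split; near: i; exact: eventually_mem.
  have [|n [s [pn Ys neqs]]] := sep i x y z Yx Yy Yz; first by case: neq; [right|left].
  by apply: (chron_time_lt _ d_ge0 _ _ _ _ _ _ _ pn _ neqs) => // t _; exact: xy.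
Unshelve. all: by end_near. Qed.
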